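(* Work in CZF + wREA. Let $\Phi$ be a bounded abstract inductive definition on a set-presented $\bigvee$-semilattice $L$. Then the smallest $\Phi$-closed class $\mathcal I(\Phi)$ is a set.
   Context: CZF is the theory in first-order intuitionistic logic with equality, in the language of $\in$, with axioms and schemes: Extensionality; Pair; Union; Restricted Separation (only formulas all of whose quantifiers are of the form $\forall x\in b$, $\exists x\in c$); Infinity; Set Induction ($\forall a((\forall x\in a)\phi(x)\to\phi(a))\to\forall a\,\phi(a)$, for all $\phi$); Strong Collection ($\forall a((\forall x\in a)\exists y\,\phi(x,y)\to\exists b((\forall x\in a)(\exists y\in b)\phi(x,y)\wedge(\forall y\in b)(\exists x\in a)\phi(x,y)))$, for all $\phi$); Subset Collection ($\forall a\forall b\exists c\forall u((\forall x\in a)(\exists y\in b)\phi(x,y,u)\to(\exists d\in c)((\forall x\in a)(\exists y\in d)\phi(x,y,u)\wedge(\forall y\in d)(\exists x\in a)\phi(x,y,u)))$, for all $\phi$). A set $c$ is weakly regular if it is transitive, inhabited, and for any $u\in c$ and any set $R\subseteq u\times c$, if $(\forall x\in u)(\exists y)\,(x,y)\in R$ then there is $v\in c$ with $(\forall x\in u)(\exists y\in v)\,(x,y)\in R$. wREA is the axiom: every set is a subset of a weakly regular set. Classes are given by formulas as usual; $\mathrm{Pow}(X)$ is the class of all subsets of $X$ (subsets are sets). A partially ordered class $(L,\leq)$ is a class with a reflexive, transitive, antisymmetric class relation. It is a $\bigvee$-semilattice if every subset of $L$ has a supremum. A $\bigvee$-semilattice $L$ is set-generated by $B$ if $B$ is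 a subset of $L$ such that for all $x\in L$: (i) $\downarrow^B x=\{b\in B\mid b\leq x\}$ is a set; (ii) $x=\bigvee\downarrow^B x$. A $\bigvee$-semilattice $L$ set-generated by $B$ is set-presented if a mapping $D:B\to\mathrm{Pow}(\mathrm{Pow}(B))$ is given such that $b\leq\bigvee U\iff(\exists W\in D(b))\,W\subseteq U$ for every $b\in B$ and $U\in\mathrm{Pow}(B)$. An abstract inductive definition on $L$ is any class of ordered pairs $\Phi\subseteq B\times L$. A bound for $\Phi$ is a set $\alpha$ such that whenever $(b,a)\in\Phi$ there is $x\in\alpha$ such that the set $\downarrow^B a$ is an image of $x$ (i.e. there is a surjection $x\twoheadrightarrow\,\downarrow^B a$). $\Phi$ is bounded if $\{b\in B\mid(b,a)\in\Phi\}$ is a set for every $a\in L$, and $\Phi$ has a bound. A subclass $Y\subseteq B$ is $c_L$-closed if for every subset $U$ of $Y$ one has $\downarrow^B\bigvee U\subseteq Y$. A class $Y\subseteq B$ is $\Phi$-closed if it is $c_L$-closed and, whenever $(b,a)\in\Phi$ and $\downarrow^B a\subseteq Y$, also $b\in Y$. $\mathcal I(\Phi)$ denotes the least (with respect to inclusion) $\Phi$-closed class; it always exists. *)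

(* Defs.v *)
From Stdlib Require Import List.
Import ListNotations.

(** De Bruijn syntax for the first-order language of [∈]; the only terms are
    variables. *)

Inductive form : Type :=
| Bot : form
| Mem : nat -> nat -> form
| Eq : nat -> nat -> form
| And : form -> form -> form
| Or : form -> form -> form
| Imp : form -> form -> form
| All : form -> form
| Ex : form -> form.

Definition scons (x : nat) (r : nat -> nat) (i : nat) : nat :=
  match i with 0 => x | S j => r j end.

Fixpoint ren (r : nat -> nat) (A : form) : form :=
  match A with
  | Bot => Bot
  | Mem x y => Mem (r x) (r y)
  | Eq x y => Eq (r x) (r y)
  | And A B => And (ren r A) (ren r B)
  | Or A B => Or (ren r A) (ren r B)
  | Imp A B => Imp (ren r A) (ren r B)
  | All A => All (ren (scons 0 (fun i => S (r i))) A)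
  | Ex A => Ex (ren (scons 0 (fun i => S (r i))) A)
  end.

(** [A] with variable [x] substituted for index 0. *)
Definition inst0 (A : form) (x : nat) : form := ren (scons x (fun i => i)) A.

(** Natural deduction from the non-logical axioms [T] and the hypotheses [G].
    Axioms may be open: since [T_ax] is available under any number of binders,
    their free variables are read as universally quantified. The variables free
    in [G], on the other hand, are parameters. *)
Inductive prv (T : form -> Prop) : list form -> form -> Prop :=
| T_ax G A : T A -> prv T G A
| Hyp G A : In A G -> prv T G A
| BotE G A : prv T G Bot -> prv T G A
| AndI G A B : prv T G A -> prv T G B -> prv T G (And A B)
| AndE1 G A B : prv T G (And A B) -> prv T G A
| AndE2 G A B : prv T G (And A B) -> prv T G B
| OrI1 G A B : prv T G A -> prv T G (Or A B)
| OrI2 G A B : prv T G B -> prv T G (Or A B)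
| OrE G A B C :
    prv T G (Or A B) -> prv T (A :: G) C -> prv T (B :: G) C -> prv T G C
| ImpI G A B : prv T (A :: G) B -> prv T G (Imp A B)
| ImpE G A B : prv T G (Imp A B) -> prv T G A -> prv T G B
| AllI G A : prv T (map (ren S) G) A -> prv T G (All A)
| AllE G A x : prv T G (All A) -> prv T G (inst0 A x)
| ExI G A x : prv T G (inst0 A x) -> prv T G (Ex A)
| ExE G A C :
    prv T G (Ex A) -> prv T (A :: map (ren S) G) (ren S C) -> prv T G C
| EqI G x : prv T G (Eq x x)
| EqE G A x y : prv T G (Eq x y) -> prv T G (inst0 A x) -> prv T G (inst0 A y).

(** Restricted formulas. The bound of a quantifier is [S b] because it may not
    be the quantified variable itself. *)
Inductive restricted : form -> Prop :=
| r_Bot : restricted Bot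
| r_Mem x y : restricted (Mem x y)
| r_Eq x y : restricted (Eq x y)
| r_And A B : restricted A -> restricted B -> restricted (And A B)
| r_Or A B : restricted A -> restricted B -> restricted (Or A B)
| r_Imp A B : restricted A -> restricted B -> restricted (Imp A B)
| r_All b A : restricted A -> restricted (All (Imp (Mem 0 (S b)) A))
| r_Ex b A : restricted A -> restricted (Ex (And (Mem 0 (S b)) A)).

(** A layer for writing formulas with named bound variables. A variable [tm] and
    a formula [fm] are given as functions of the number [d] of quantifiers in
    whose scope they are placed. The variable bound by a quantifier at depth [d]
    has index [d' - S d] at depth [d' >= S d]; the free variable (parameter) [i]
    has index [d + i] at depth [d]. *)

Definition tm := nat -> nat.
Definition fm := nat -> form.

Definition par (i : nat) : tm := fun d => d + i.
Definition close (F : fm) : form := F 0.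

Definition fmem (x y : tm) : fm := fun d => Mem (x d) (y d).
Definition feq (x y : tm) : fm := fun d => Eq (x d) (y d).
Definition fand (F G : fm) : fm := fun d => And (F d) (G d).
Definition for_ (F G : fm) : fm := fun d => Or (F d) (G d).
Definition fimp (F G : fm) : fm := fun d => Imp (F d) (G d).
Definition fiff (F G : fm) : fm := fand (fimp F G) (fimp G F).
Definition fall (F : tm -> fm) : fm :=
  fun d => All (F (fun d' => d' - S d) (S d)).
Definition fex (F : tm -> fm) : fm :=
  fun d => Ex (F (fun d' => d' - S d) (S d)).

(** [A(x_0, ..., x_{n-1})]: the first [n] indices of [A] are its arguments, and
    index [n + i] of [A] is the parameter [i]. *)
Definition inst (A : form) (xs : list tm) : fm := fun d =>
  ren (fun i => nth i (map (fun x => x d) xs) (d + (i - length xs))) A.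

Declare Scope fm_scope.
Delimit Scope fm_scope with fm.
Bind Scope fm_scope with fm.

Notation "x ∈ y" := (fmem x y) (at level 70) : fm_scope.
Notation "x ≡ y" := (feq x y) (at level 70) : fm_scope.
Notation "F ∧ G" := (fand F G) (at level 80, right associativity) : fm_scope.
Notation "F ∨ G" := (for_ F G) (at level 85, right associativity) : fm_scope.
Notation "F ⇒ G" := (fimp F G) (at level 90, right associativity) : fm_scope.
Notation "F ⇔ G" := (fiff F G) (at level 95, no associativity) : fm_scope.
Notation "'FA' x , F" := (fall (fun x => F%fm))
  (at level 200, x name, F at level 200) : fm_scope.
Notation "'EX' x , F" := (fex (fun x => F%fm))
  (at level 200, x name, F at level 200) : fm_scope.
Notation "'FA' x 'IN' A , F" := (fall (fun x => fimp (A x) F%fm))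
  (at level 200, x name, A at level 60, F at level 200) : fm_scope.
Notation "'EX' x 'IN' A , F" := (fex (fun x => fand (A x) F%fm))
  (at level 200, x name, A at level 60, F at level 200) : fm_scope.

Local Open Scope fm_scope.

(** A class is [cl A] for a formula [A], in which index 0 stands for the element
    and index [S i] for the parameter [i]; a set [s] is also the class [el s]. *)
Definition cls := tm -> fm.
Definition cl (A : form) : cls := fun x => inst A [x].
Definition el (s : tm) : cls := fun x => x ∈ s.

Definition sub (X Y : cls) : fm := FA x IN X, Y x.
Definition represents (s : tm) (X : cls) : fm := FA x, x ∈ s ⇔ X x.
Definition is_set (X : cls) : fm := EX s, represents s X.
Definition Pow (X : cls) : cls := fun y => sub (el y) X.

(** [z = {x, y}] and the Kuratowski pair [p = (x, y) = {{x}, {x, y}}]. *)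
Definition is_upair (z x y : tm) : fm := FA w, w ∈ z ⇔ (w ≡ x ∨ w ≡ y).
Definition is_pair (p x y : tm) : fm :=
  FA z, z ∈ p ⇔ (is_upair z x x ∨ is_upair z x y).

(** [(x, y) ∈ R], and [R ⊆ X × Y]. *)
Definition rel (R : cls) (x y : tm) : fm := EX p IN R, is_pair p x y.
Definition sub_prod (R X Y : cls) : fm :=
  FA p IN R, EX x IN X, EX y IN Y, is_pair p x y.

Definition mapping (F X Y : cls) : fm :=
  sub_prod F X Y ∧
  FA x IN X, EX y, rel F x y ∧ FA y', rel F x y' ⇒ y' ≡ y.
Definition surjection (F X Y : cls) : fm :=
  mapping F X Y ∧ FA y IN Y, EX x IN X, rel F x y.

(** In the schemes, [A] may also mention as parameters the sets that the
    instance quantifies in front ([a], or [a] and [b]): instantiate these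
    quantifiers with the parameters. *)
Inductive CZF : form -> Prop :=
| extensionality : CZF (close (
    FA a, FA b, (FA x, x ∈ a ⇔ x ∈ b) ⇒ a ≡ b))
| pairing : CZF (close (
    FA a, FA b, EX c, FA x, x ∈ c ⇔ (x ≡ a ∨ x ≡ b)))
| union : CZF (close (
    FA a, EX b, FA x, x ∈ b ⇔ EX y IN el a, x ∈ y))
| restricted_separation A : restricted A -> CZF (close (
    FA a, EX b, FA x, x ∈ b ⇔ (x ∈ a ∧ inst A [x])))
| infinity : CZF (close (
    EX a, (EX x, x ∈ a) ∧ FA x IN el a, EX y IN el a, x ∈ y))
| set_induction A : CZF (close (
    (FA a, (FA x IN el a, inst A [x]) ⇒ inst A [a]) ⇒ FA a, inst A [a]))
| strong_collection A : CZF (close (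
    FA a, (FA x IN el a, EX y, inst A [x; y]) ⇒
      EX b, (FA x IN el a, EX y IN el b, inst A [x; y]) ∧
            (FA y IN el b, EX x IN el a, inst A [x; y])))
| subset_collection A : CZF (close (
    FA a, FA b, EX c, FA u,
      (FA x IN el a, EX y IN el b, inst A [x; y; u]) ⇒
      EX d IN el c,
        (FA x IN el a, EX y IN el d, inst A [x; y; u]) ∧
        (FA y IN el d, EX x IN el a, inst A [x; y; u]))).

Definition weakly_regular (c : tm) : fm :=
  (FA x IN el c, sub (el x) (el c)) ∧
  (EX x, x ∈ c) ∧
  FA u IN el c, FA R,
    sub_prod (el R) (el u) (el c) ⇒
    (FA x IN el u, EX y, rel (el R) x y) ⇒
    EX v IN el c, FA x IN el u, EX y IN el v, rel (el R) x y.

Definition wREA : form := close (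
  FA a, EX c, weakly_regular c ∧ sub (el a) (el c)).

Inductive CZF_wREA : form -> Prop :=
| CZF_ax A : CZF A -> CZF_wREA A
| wREA_ax : CZF_wREA wREA.

(** The relations [leq], [Phi] and the mapping [D] are classes of ordered pairs;
    [B] is a set. *)

Definition partial_order (L leq : cls) : fm :=
  sub_prod leq L L ∧
  (FA x IN L, rel leq x x) ∧
  (FA x IN L, FA y IN L, FA z IN L, rel leq x y ⇒ rel leq y z ⇒ rel leq x z) ∧
  (FA x IN L, FA y IN L, rel leq x y ⇒ rel leq y x ⇒ x ≡ y).

Definition is_sup (L leq : cls) (U s : tm) : fm :=
  L s ∧
  (FA u IN el U, rel leq u s) ∧
  (FA z IN L, (FA u IN el U, rel leq u z) ⇒ rel leq s z).

Definition semilattice (L leq : cls) : fm :=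
  partial_order L leq ∧ FA U, sub (el U) L ⇒ EX s, is_sup L leq U s.

Definition down (leq : cls) (B x : tm) : cls := fun b => b ∈ B ∧ rel leq b x.

Definition set_generated (L leq : cls) (B : tm) : fm :=
  sub (el B) L ∧
  FA x IN L,
    is_set (down leq B x) ∧
    FA s, represents s (down leq B x) ⇒ is_sup L leq s x.

Definition set_presented (L leq : cls) (B : tm) (D : cls) : fm :=
  semilattice L leq ∧
  set_generated L leq B ∧
  mapping D (el B) (Pow (Pow (el B))) ∧
  FA b IN el B, FA U IN Pow (el B), FA s, is_sup L leq U s ⇒
    (rel leq b s ⇔
     EX Db, rel D b Db ∧ EX W IN el Db, sub (el W) (el U)).

Definition abstract_inductive_definition (L : cls) (B : tm) (Phi : cls) : fm :=
  sub_prod Phi (el B) L.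

Definition is_bound (leq : cls) (B : tm) (Phi : cls) (alpha : tm) : fm :=
  FA b, FA a, rel Phi b a ⇒
    EX x IN el alpha, EX f, surjection (el f) (el x) (down leq B a).

Definition bounded (L leq : cls) (B : tm) (Phi : cls) : fm :=
  (FA a IN L, is_set (fun b => b ∈ B ∧ rel Phi b a)) ∧
  EX alpha, is_bound leq B Phi alpha.

Definition cL_closed (L leq : cls) (B : tm) (Y : cls) : fm :=
  FA U, sub (el U) Y ⇒ FA s, is_sup L leq U s ⇒ sub (down leq B s) Y.

Definition Phi_closed (L leq : cls) (B : tm) (Phi Y : cls) : fm :=
  sub Y (el B) ∧
  cL_closed L leq B Y ∧
  FA b, FA a, rel Phi b a ⇒ sub (down leq B a) Y ⇒ Y b.

(** [I] is the least [Phi]-closed class, provably in [T] from [G]. Leastness is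
    a scheme, ranging over all classes [Y], with arbitrary parameters. *)
Definition least_Phi_closed (T : form -> Prop) (G : list form)
    (L leq : cls) (B : tm) (Phi I : cls) : Prop :=
  prv T G (close (Phi_closed L leq B Phi I)) /\
  forall Y : form,
    prv T G (close (Phi_closed L leq B Phi (cl Y) ⇒ sub I (cl Y))).

(* Main.v *)
(** A class [Y] that is [Phi]-closed contains a [Phi]-closed set, so [I(Phi)] is
    the intersection of all closed sets. To find the set, let [beta] consist of
    the bound of [Phi] and of all [W ∈ D(b)]. By Subset Collection one set [C]
    contains every [X ⊆ B] that is the image of an element of [beta]. Only the
    rules "from [X ∈ C] infer [b] if [b ≤ ⋁X] or [(b, ⋁X) ∈ Phi]" are iterated,
    along [∈]: stage [x] consists of the conclusions of rules whose premises lie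
    in stages [y ∈ x]. Stages are sets, and they lie in [Y]. If [A] is weakly
    regular and contains [beta], then the union of the stages [x ∈ A] is closed:
    premises that are the image of some [u ∈ beta] are all reached at stages in
    one [v ∈ A], so the conclusion is reached at stage [v].

    Since derivations can be renamed, the relation [w ⊩ F], "[F] is provable from
    [w]", satisfies Kripke-style clauses in which a universal quantifier ranges
    over the parameters. The set-theoretic argument uses only these clauses. *)

Require Import Defs.
From Stdlib Require Import List Lia PeanoNat.
Import ListNotations.
Local Open Scope fm_scope.

(** * Renaming of derivations *)

Definition up (r : nat -> nat) : nat -> nat := scons 0 (fun i => S (r i)).

(** Every free index of [A] is smaller than [bnd A]; the [pred] accounts for the index that a
    quantifier binds. *)
Fixpoint bnd (A : form) : nat :=
  match A with
  | Bot => 0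
  | Mem x y | Eq x y => S (max x y)
  | And A B | Or A B | Imp A B => max (bnd A) (bnd B)
  | All A | Ex A => pred (bnd A)
  end.

Lemma ren_ext_bnd A r s : (forall i, i < bnd A -> r i = s i) -> ren r A = ren s A.
Proof.
  revert r s; induction A; simpl; intros r s H; f_equal;
    try solve [reflexivity | apply H; lia
              | apply IHA1; intros; apply H; lia | apply IHA2; intros; apply H; lia];
    apply IHA; (intros [|i] Hi; simpl; [reflexivity|f_equal; apply H; lia]).
Qed.

Lemma ren_ext A r s : (forall i, r i = s i) -> ren r A = ren s A.
Proof. intros H; apply ren_ext_bnd; auto. Qed.

Lemma ren_comp A r s : ren r (ren s A) = ren (fun i => r (s i)) A.
Proof.
  revert r s; induction A; simpl; intros r s; rewrite ?IHA1, ?IHA2, ?IHA;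
    auto; f_equal; apply ren_ext; intros [|i]; reflexivity.
Qed.

Lemma ren_id A : ren (fun i => i) A = A.
Proof.
  induction A; simpl; f_equal; auto;
    rewrite <- IHA at 2; apply ren_ext; intros [|i]; reflexivity.
Qed.

Lemma ren_inst0 r A x : ren r (inst0 A x) = inst0 (ren (up r) A) (r x).
Proof. unfold inst0; rewrite !ren_comp; apply ren_ext; intros [|i]; reflexivity. Qed.

Lemma map_ren_up r G : map (ren (up r)) (map (ren S) G) = map (ren S) (map (ren r) G).
Proof.
  rewrite !map_map; apply map_ext; intros A.
  rewrite !ren_comp; apply ren_ext; reflexivity.
Qed.

(** The outermost of [S k] quantifiers binds index [k] of [A]. Instantiating it by [x k] leaves [k]
    quantifiers and a changed renaming, which is why [r] is general in the induction. *)
Lemma iter_All_inst T G A k : forall r,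
  prv T G (ren r (Nat.iter k All A)) ->
  forall x : nat -> nat,
  prv T G (ren (fun i => if i <? k then x i else r (i - k)) A).
Proof.
  induction k as [|k IH]; simpl; intros r H x.
  - erewrite ren_ext; [exact H|]. intros i; simpl; f_equal; lia.
  - apply AllE with (x := x k) in H; unfold inst0 in H; rewrite ren_comp in H.
    eapply IH with (x := x) in H; erewrite ren_ext; [exact H|].
    intros i; simpl. destruct (Nat.ltb_spec i k), (Nat.ltb_spec i (S k));
      simpl; try lia; auto.
    + replace (i - k) with 0 by lia; simpl; f_equal; lia.
    + destruct (i - k) eqn:E; [lia|]; simpl; f_equal; lia.
Qed.

(** [T] need not be closed under renaming, but an axiom can be generalized over
    all its variables and instantiated again. *)
Lemma prv_ax_ren (T : form -> Prop) G A r : T A -> prv T G (ren r A).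
Proof.
  intros HA.
  assert (H : forall k G, prv T G (Nat.iter k All A)).
  { induction k; intros G'; simpl; [now apply T_ax|now apply AllI]. }
  (* With [bnd A] quantifiers all free indices are bound, so only the chosen instances [r i]
     matter. *)
  specialize (H (bnd A) G); rewrite <- ren_id in H.
  apply iter_All_inst with (x := r) in H.
  erewrite ren_ext_bnd; [exact H|]. intros i Hi; simpl.
  now apply Nat.ltb_lt in Hi; rewrite Hi.
Qed.

Lemma prv_weaken T G G' A : prv T G A -> incl G G' -> prv T G' A.
Proof.
  intros H; revert G'; induction H; intros G' HG.
  - now apply T_ax.
  - apply Hyp; auto.
  - apply BotE; auto.
  - apply AndI; auto.
  - eapply AndE1; eauto.
  - eapply AndE2; eauto.
  - apply OrI1; auto.
  - apply OrI2; auto.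
  - eapply OrE; [apply IHprv1|apply IHprv2|apply IHprv3]; auto;
      intros C' [->|]; simpl; auto.
  - apply ImpI, IHprv; intros C' [->|]; simpl; auto.
  - eapply ImpE; auto.
  - apply AllI, IHprv, incl_map, HG.
  - apply AllE; auto.
  - eapply ExI; eauto.
  - eapply ExE; [apply IHprv1; auto|apply IHprv2].
    intros C' [->|]; simpl; auto. right; now apply (incl_map (ren S) HG).
  - apply EqI.
  - eapply EqE; eauto.
Qed.

Lemma prv_ren T G A : prv T G A -> forall r, prv T (map (ren r) G) (ren r A).
Proof.
  induction 1; intros r; simpl in *.
  - now apply prv_ax_ren.
  - now apply Hyp, in_map.
  - apply BotE; auto.
  - apply AndI; auto.
  - eapply AndE1; eauto.
  - eapply AndE2; eauto.
  - apply OrI1; auto.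
  - apply OrI2; auto.
  - eapply OrE; auto.
  - apply ImpI; auto.
  - eapply ImpE; auto.
  - apply AllI; rewrite <- map_ren_up; apply IHprv.
  - rewrite ren_inst0; apply AllE, IHprv.
  - apply ExI with (r x); fold (up r); rewrite <- ren_inst0; apply IHprv.
  - eapply ExE; [apply IHprv1|]. fold (up r).
    rewrite <- map_ren_up.
    replace (ren S (ren r C)) with (ren (up r) (ren S C))
      by (rewrite !ren_comp; apply ren_ext; reflexivity).
    apply IHprv2.
  - apply EqI.
  - rewrite ren_inst0; eapply EqE; [apply IHprv1|].
    rewrite <- ren_inst0; apply IHprv2.
Qed.

(** * Fresh parameters *)

Definition ctx_bnd (G : list form) : nat := list_max (map bnd G).

(** The renaming turns the parameter [n] into index 0 and shifts all others. Where [n] is fresh it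
    is the plain shift that [AllI] and [ExE] demand. *)
Lemma ren_fresh_ctx G n : ctx_bnd G <= n ->
  map (ren (fun i => if i =? n then 0 else S i)) G = map (ren S) G.
Proof.
  intros H; apply map_ext_in; intros A HA; apply ren_ext_bnd; intros i Hi.
  destruct (Nat.eqb_spec i n); auto.
  unfold ctx_bnd in H; rewrite list_max_le, Forall_map, Forall_forall in H.
  specialize (H A HA); lia.
Qed.

Lemma ren_fresh_inst0 A n : bnd A <= n ->
  ren (fun i => if i =? n then 0 else S i) (inst0 A n) = A.
Proof.
  intros H; unfold inst0; rewrite ren_comp, <- ren_id; apply ren_ext_bnd.
  intros [|i] Hi; simpl; [now rewrite Nat.eqb_refl|].
  destruct (Nat.eqb_spec i n); auto; lia.
Qed.

(** Quantifying over all parameters includes a fresh one. *)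
Lemma prv_All_intro T G A : (forall x, prv T G (inst0 A x)) -> prv T G (All A).
Proof.
  intros H; set (n := max (ctx_bnd G) (bnd A)).
  specialize (H n); apply prv_ren with (r := fun i => if i =? n then 0 else S i) in H.
  rewrite ren_fresh_ctx, ren_fresh_inst0 in H by lia. now apply AllI.
Qed.

Lemma prv_Ex_elim T G A C :
  prv T G (Ex A) -> (forall x, prv T (inst0 A x :: G) C) -> prv T G C.
Proof.
  intros HE H; set (n := max (ctx_bnd (C :: G)) (bnd A)).
  specialize (H n); apply prv_ren with (r := fun i => if i =? n then 0 else S i) in H.
  assert (E : map (ren (fun i => if i =? n then 0 else S i)) (C :: G) = map (ren S) (C :: G))
    by (apply ren_fresh_ctx; lia).
  simpl in E, H; injection E as EC EG.
  rewrite EC, EG, ren_fresh_inst0 in H by lia. eapply ExE; eauto.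
Qed.

(** * Formulas with arguments *)

Coercion par : nat >-> tm.

(** From depth [d] on, [t] denotes one fixed variable. *)
Definition good (d : nat) (t : tm) : Prop := forall k, t (k + d) = k + t d.

Lemma good_S d t : good d t -> good (S d) t.
Proof.
  intros H k. replace (k + S d) with (S k + d) by lia.
  rewrite H. specialize (H 1); simpl in *; rewrite H; lia.
Qed.

Lemma good_at_S d t : good d t -> t (S d) = S (t d).
Proof. exact (fun H => H 1). Qed.

Lemma good_par d (x : nat) : good d x.
Proof. intros k; unfold par; lia. Qed.

Lemma good_bound k d : k < d -> good d (fun d' => d' - S k).
Proof. intros H j; lia. Qed.

Definition env := nat -> tm.

(** Index [i < n] stands for the argument [e i], and index [n + i] for the
    parameter [i]. *)
Definition interp (n : nat) (e : env) (d : nat) : nat -> nat :=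
  fun i => if i <? n then e i d else d + (i - n).

Definition uniform_tm (n : nat) (t : env -> tm) : Prop :=
  exists i, forall e d, t e d = interp n e d i.

(** The Rocq function [F] of the first [n] entries of the environment is given by a
    de Bruijn formula, so that schemes and quantifier rules apply to it. *)
Definition uniform (n : nat) (F : env -> fm) : Prop :=
  exists A, forall d e, (forall i, i < n -> good d (e i)) ->
    F e d = ren (interp n e d) A.

Lemma uniform_tm_var n i : (i <? n) = true -> uniform_tm n (fun e => e i).
Proof. intros H; exists i; intros e d; unfold interp; now rewrite H. Qed.

Lemma uniform_tm_par n (x : nat) : uniform_tm n (fun _ => x).
Proof.
  exists (n + x); intros e d; unfold interp, par.
  destruct (Nat.ltb_spec (n + x) n); lia.
Qed.

Lemma uniform_mem n s t :
  uniform_tm n s -> uniform_tm n t -> uniform n (fun e => s e ∈ t e).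
Proof.
  intros [i Hi] [j Hj]; exists (Mem i j); intros d e _.
  unfold fmem; simpl; now rewrite Hi, Hj.
Qed.

Lemma uniform_eq n s t :
  uniform_tm n s -> uniform_tm n t -> uniform n (fun e => s e ≡ t e).
Proof.
  intros [i Hi] [j Hj]; exists (Eq i j); intros d e _.
  unfold feq; simpl; now rewrite Hi, Hj.
Qed.

Lemma uniform_and n F G : uniform n F -> uniform n G -> uniform n (fun e => F e ∧ G e).
Proof.
  intros [A HA] [C HC]; exists (And A C); intros d e He.
  unfold fand; simpl; now rewrite HA, HC.
Qed.

Lemma uniform_or n F G : uniform n F -> uniform n G -> uniform n (fun e => F e ∨ G e).
Proof.
  intros [A HA] [C HC]; exists (Or A C); intros d e He.
  unfold for_; simpl; now rewrite HA, HC.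
Qed.

Lemma uniform_imp n F G : uniform n F -> uniform n G -> uniform n (fun e => F e ⇒ G e).
Proof.
  intros [A HA] [C HC]; exists (Imp A C); intros d e He.
  unfold fimp; simpl; now rewrite HA, HC.
Qed.

(** Entering a quantifier at depth [d] pushes the variable [d' - S d] onto the environment; on
    indices this is [up]. *)
Lemma interp_up n (e : env) d : (forall i, i < n -> good d (e i)) -> forall i,
  interp (S n) (fun i => match i with 0 => fun d' => d' - S d | S i => e i end) (S d) i
  = up (interp n e d) i.
Proof.
  intros He [|i]; unfold interp; simpl; [lia|].
  change (S i <? S n) with (i <? n).
  destruct (Nat.ltb_spec i n); simpl; auto. now apply good_at_S, He.
Qed.

Lemma uniform_body n (F : env -> tm -> fm) :
  uniform (S n) (fun e => F (fun i => e (S i)) (e 0)) ->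
  exists A, forall d e, (forall i, i < n -> good d (e i)) ->
    F e (fun d' => d' - S d) (S d) = ren (up (interp n e d)) A.
Proof.
  intros [A HA]; exists A; intros d e He.
  specialize (HA (S d) (fun i => match i with 0 => fun d' => d' - S d | S i => e i end)).
  rewrite (ren_ext _ _ _ (interp_up n e d He)) in HA; apply HA.
  intros [|i] Hi; [apply good_bound; lia|apply good_S, He; lia].
Qed.

Lemma uniform_all n F :
  uniform (S n) (fun e => F (fun i => e (S i)) (e 0)) ->
  uniform n (fun e => fall (F e)).
Proof.
  intros [A HA]%uniform_body; exists (All A); intros d e He; unfold fall; simpl.
  f_equal; now apply HA.
Qed.

Lemma uniform_ex n F :
  uniform (S n) (fun e => F (fun i => e (S i)) (e 0)) ->
  uniform n (fun e => fex (F e)).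
Proof.
  intros [A HA]%uniform_body; exists (Ex A); intros d e He; unfold fex; simpl.
  f_equal; now apply HA.
Qed.

Lemma uniform_inst1 n A t : uniform_tm n t -> uniform n (fun e => inst A [t e]).
Proof.
  intros [j Hj]; exists (ren (fun i => match i with 0 => j | S i => n + i end) A).
  intros d e _; unfold inst; rewrite ren_comp; apply ren_ext; intros [|i]; simpl; auto.
  unfold interp; destruct (Nat.ltb_spec (n + i) n); destruct i; simpl; lia.
Qed.

Definition uniform1 (P : tm -> fm) := uniform 1 (fun e => P (e 0)).
Definition uniform2 (P : tm -> tm -> fm) := uniform 2 (fun e => P (e 0) (e 1)).
Definition uniform3 (P : tm -> tm -> tm -> fm) :=
  uniform 3 (fun e => P (e 0) (e 1) (e 2)).

(** Change of variables: it lets a predicate known only to be uniform, such as an arbitrary class,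
    occur inside larger formulas with any variables as arguments. *)
Lemma uniform_subst m n F (t : nat -> env -> tm) (r : nat -> nat) :
  uniform m F ->
  (forall i e d, i < m -> t i e d = interp n e d (r i)) ->
  uniform n (fun e => F (fun i => t i e)).
Proof.
  intros [A HA] Ht.
  exists (ren (fun i => if i <? m then r i else n + (i - m)) A); intros d e He.
  rewrite HA, ren_comp.
  - apply ren_ext; intros i; unfold interp at 1.
    destruct (Nat.ltb_spec i m) as [Hi|Hi]; [now apply Ht|].
    unfold interp; destruct (Nat.ltb_spec (n + (i - m)) n); lia.
  - intros i Hi k; rewrite !Ht by auto; unfold interp.
    destruct (Nat.ltb_spec (r i) n); [now apply He|lia].
Qed.

Lemma uniform1_app n P s :
  uniform1 P -> uniform_tm n s -> uniform n (fun e => P (s e)).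
Proof.
  intros HP [i Hi].
  apply (uniform_subst 1 n _ (fun _ => s) (fun _ => i) HP); auto.
Qed.

Lemma uniform2_app n P s t :
  uniform2 P -> uniform_tm n s -> uniform_tm n t ->
  uniform n (fun e => P (s e) (t e)).
Proof.
  intros HP [i Hi] [j Hj].
  apply (uniform_subst 2 n _ (fun k => match k with 0 => s | _ => t end)
    (fun k => match k with 0 => i | _ => j end) HP).
  intros [|k]; auto.
Qed.

Lemma uniform3_app n P s t u :
  uniform3 P -> uniform_tm n s -> uniform_tm n t -> uniform_tm n u ->
  uniform n (fun e => P (s e) (t e) (u e)).
Proof.
  intros HP [i Hi] [j Hj] [l Hl].
  apply (uniform_subst 3 n _ (fun k => match k with 0 => s | 1 => t | _ => u end)
    (fun k => match k with 0 => i | 1 => j | _ => l end) HP).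
  intros [|[|k]]; auto.
Qed.

Lemma uniform_cl A : uniform1 (cl A).
Proof. now apply uniform_inst1, uniform_tm_var. Qed.

(** Brings a uniform predicate into the form in which the axiom schemes state their instances. The
    default [par 0] is harmless because only the first [n] entries of the environment enter. *)
Lemma uniform_rep n (F : env -> fm) : uniform n F ->
  exists A, forall d (ts : list tm), length ts = n -> Forall (good d) ts ->
    F (fun i => nth i ts (par 0)) d = inst A ts d.
Proof.
  intros [A HA]; exists A; intros d ts Hn Hts; rewrite HA; unfold inst.
  - apply ren_ext; intros i; unfold interp; subst n.
    destruct (Nat.ltb_spec i (length ts)) as [Hi|Hi].
    + rewrite nth_indep with (l := map _ ts) (d' := par 0 d)
        by now rewrite length_map.
      now rewrite (map_nth (fun x : tm => x d) ts (par 0)).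
    + symmetry; apply nth_overflow; now rewrite length_map.
  - subst n; intros i Hi; rewrite Forall_forall in Hts; apply Hts, nth_In, Hi.
Qed.

(** * Forcing clauses and tactics *)

Definition force (w : list form) (F : fm) : Prop := prv CZF_wREA w (close F).

Notation "w ⊩ F" := (force w F) (at level 98, F at level 97, no associativity).

Create HintDb fm_defs.
#[local] Hint Unfold fiff sub represents is_set Pow is_upair is_pair rel sub_prod
  mapping surjection weakly_regular el partial_order is_sup semilattice down
  set_generated set_presented abstract_inductive_definition is_bound bounded
  cL_closed Phi_closed : fm_defs.

(** Uniformity follows the syntax of the unfolded formula; at a predicate variable the matching
    hypothesis in the context is used. *)
Ltac unif :=
  unfold uniform1, uniform2, uniform3; autounfold with fm_defs; cbv beta;
  solve [repeat lazymatch goal with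
  | |- uniform_tm _ (fun e => e _) => apply uniform_tm_var; reflexivity
  | |- uniform_tm _ (fun _ => par _) => apply uniform_tm_par
  | |- uniform _ (fun e => fmem _ _) => apply uniform_mem
  | |- uniform _ (fun e => feq _ _) => apply uniform_eq
  | |- uniform _ (fun e => fand _ _) => apply uniform_and
  | |- uniform _ (fun e => for_ _ _) => apply uniform_or
  | |- uniform _ (fun e => fimp _ _) => apply uniform_imp
  | |- uniform _ (fun e => fall _) => apply uniform_all; cbv beta
  | |- uniform _ (fun e => fex _) => apply uniform_ex; cbv beta
  | H : uniform1 ?P |- uniform _ (fun e => ?P _) => apply (uniform1_app _ P _ H)
  | H : uniform2 ?P |- uniform _ (fun e => ?P _ _) => apply (uniform2_app _ P _ _ H)
  | H : uniform3 ?P |- uniform _ (fun e => ?P _ _ _) => apply (uniform3_app _ P _ _ _ H)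
  | |- uniform _ (fun e => inst _ _) => apply uniform_inst1
  end].

(** At depth 0 the bound variable of [fall F] is [fun d => d - 1]. Uniformity makes the body at
    depth 1 and [F x] at depth 0 renamings of one formula, so that they can be compared. *)
Lemma inst0_body (F : tm -> fm) (x : nat) :
  uniform1 F -> inst0 (F (fun d => d - 1) 1) x = F x 0.
Proof.
  intros [A HA].
  pose proof (HA 0 (fun _ => x) (fun _ _ => good_par 0 x)) as H0.
  pose proof (HA 1 (fun _ d => d - 1) (fun _ _ => good_bound 0 1 (le_n 1))) as H1.
  simpl in H0, H1; unfold inst0; rewrite H0, H1, ren_comp; apply ren_ext.
  intros [|i]; unfold interp, par; simpl; auto.
Qed.

Lemma force_weaken w w' F : incl w w' -> w ⊩ F -> w' ⊩ F.
Proof. intros H HF; eapply prv_weaken; eauto. Qed.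

Lemma force_all_intro w F : uniform1 F -> (forall x : nat, w ⊩ F x) -> w ⊩ fall F.
Proof. intros HF H; apply prv_All_intro; intros x; rewrite inst0_body; auto; apply H. Qed.

Lemma force_all_elim w F (x : nat) : uniform1 F -> w ⊩ fall F -> w ⊩ F x.
Proof. intros HF H; unfold force, close; rewrite <- inst0_body by auto; now apply AllE. Qed.

Lemma force_ex_intro w F (x : nat) : uniform1 F -> w ⊩ F x -> w ⊩ fex F.
Proof. intros HF H; eapply ExI; rewrite inst0_body by auto; exact H. Qed.

Lemma force_ex_elim w F C : uniform1 F -> w ⊩ fex F ->
  (forall w' (x : nat), incl w w' -> w' ⊩ F x -> w' ⊩ C) -> w ⊩ C.
Proof.
  intros HF H HC; eapply prv_Ex_elim; [exact H|]; intros x.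
  rewrite inst0_body by auto; apply HC with x; [apply incl_tl, incl_refl|].
  apply Hyp; left; reflexivity.
Qed.

Lemma force_imp_intro w F G : (forall w', incl w w' -> w' ⊩ F -> w' ⊩ G) -> w ⊩ F ⇒ G.
Proof.
  intros H; apply ImpI, H; [apply incl_tl, incl_refl|]. apply Hyp; left; reflexivity.
Qed.

Lemma force_imp_elim w F G : w ⊩ F ⇒ G -> w ⊩ F -> w ⊩ G.
Proof. apply ImpE. Qed.

Lemma force_and_intro w F G : w ⊩ F -> w ⊩ G -> w ⊩ F ∧ G.
Proof. apply AndI. Qed.

Lemma force_and_elim w F G : w ⊩ F ∧ G -> (w ⊩ F) /\ (w ⊩ G).
Proof. intros H; split; [eapply AndE1|eapply AndE2]; exact H. Qed.

Lemma force_or_left w F G : w ⊩ F -> w ⊩ F ∨ G.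
Proof. apply OrI1. Qed.

Lemma force_or_right w F G : w ⊩ G -> w ⊩ F ∨ G.
Proof. apply OrI2. Qed.

Lemma force_or_elim w F G C : w ⊩ F ∨ G ->
  (forall w', incl w w' -> w' ⊩ F -> w' ⊩ C) ->
  (forall w', incl w w' -> w' ⊩ G -> w' ⊩ C) -> w ⊩ C.
Proof.
  intros H HF HG; eapply OrE; [exact H| |];
    [apply HF|apply HG]; try (apply incl_tl, incl_refl); apply Hyp; left; reflexivity.
Qed.

Lemma force_refl w (x : nat) : w ⊩ x ≡ x.
Proof. apply EqI. Qed.

Lemma force_subst w (P : tm -> fm) (x y : nat) : uniform1 P -> w ⊩ x ≡ y -> w ⊩ P x -> w ⊩ P y.
Proof.
  intros HP H; unfold force, close; rewrite <- !inst0_body by auto.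
  apply EqE, H.
Qed.

Lemma force_sym w (x y : nat) : w ⊩ x ≡ y -> w ⊩ y ≡ x.
Proof. intros H; apply (force_subst w (fun t => t ≡ x) x y); [unif|exact H|apply force_refl]. Qed.

(** [Q] is [F] with its outer [FA], [⇒] and [∧] replaced by Rocq's connectives. *)
Definition reads (w : list form) (F : fm) (Q : Prop) := w ⊩ F -> Q.

Lemma reads_all w F (Q : nat -> Prop) : uniform1 F ->
  (forall x, reads w (F (par x)) (Q x)) -> reads w (fall F) (forall x, Q x).
Proof. intros HF HQ H x; now apply HQ, force_all_elim. Qed.

Lemma reads_imp w F G (Q : Prop) : reads w G Q -> reads w (F ⇒ G) (w ⊩ F -> Q).
Proof. intros HQ H HF; now apply HQ, force_imp_elim with F. Qed.

Lemma reads_and w F G P Q : reads w F P -> reads w G Q -> reads w (F ∧ G) (P /\ Q).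
Proof. intros HP HQ H; apply force_and_elim in H; split; [apply HP|apply HQ]; apply H. Qed.

Lemma reads_iff w F G : reads w (F ⇔ G) ((w ⊩ F -> w ⊩ G) /\ (w ⊩ G -> w ⊩ F)).
Proof.
  intros [H1 H2]%force_and_elim; split; intros H; eapply force_imp_elim; eassumption.
Qed.

Ltac reading :=
  cbv beta;
  lazymatch goal with
  | |- reads _ (fall _) _ => refine (reads_all _ _ _ _ _); [unif|intros ?; reading]
  | |- reads _ (fimp _ _) _ => refine (reads_imp _ _ _ _ _); reading
  | |- reads _ (fand _ _) _ => refine (reads_and _ _ _ _ _ _ _); reading
  | |- reads _ (fiff _ _) _ => exact (reads_iff _ _ _)
  | |- reads _ (sub _ _) _ => unfold sub; reading
  | |- reads _ (represents _ _) _ => unfold represents; reading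
  | |- reads _ (is_upair _ _ _) _ => unfold is_upair; reading
  | |- reads _ (is_pair _ _ _) _ => unfold is_pair; reading
  | |- reads _ (sub_prod _ _ _) _ => unfold sub_prod; reading
  | |- reads _ (abstract_inductive_definition _ _ _) _ =>
      unfold abstract_inductive_definition; reading
  | |- reads _ (mapping _ _ _) _ => unfold mapping; reading
  | |- reads _ (surjection _ _ _) _ => unfold surjection; reading
  | |- reads _ (weakly_regular _) _ => unfold weakly_regular; reading
  | |- reads _ (partial_order _ _) _ => unfold partial_order; reading
  | |- reads _ (semilattice _ _) _ => unfold semilattice; reading
  | |- reads _ (set_generated _ _ _) _ => unfold set_generated; reading
  | |- reads _ (set_presented _ _ _ _) _ => unfold set_presented; reading
  | |- reads _ (bounded _ _ _ _) _ => unfold bounded; reading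
  | |- reads _ (is_bound _ _ _ _) _ => unfold is_bound; reading
  | |- reads _ (cL_closed _ _ _ _) _ => unfold cL_closed; reading
  | |- reads _ (Phi_closed _ _ _ _ _) _ => unfold Phi_closed; reading
  | |- reads _ (down _ _ _ _) _ => unfold down; reading
  | |- reads _ (el _ _) _ => unfold el; reading
  | |- _ => exact (fun H => H)
  end.

(** The reading [Q] starts as an existential variable, which [reading] fills in while it descends
    through the formula. *)
Ltac read H :=
  lazymatch type of H with force ?w ?F =>
    let Q := fresh in evar (Q : Prop);
    let R := fresh in
    assert (R : reads w F Q); [subst Q; reading|];
    apply R in H; subst Q; clear R; cbv beta in H
  end.

(** By monotonicity of forcing, all facts at [w] move to the extension [v], so that a proof always
    works in one current context. *)
Ltac lift Hle :=
  lazymatch type of Hle with incl ?w ?v =>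
    repeat match goal with
    | H : force w _ |- _ => apply (force_weaken w v _ Hle) in H
    end;
    clear Hle; try clear w
  end.

Tactic Notation "fintro" ident(x) :=
  apply force_all_intro; [unif|intros x; cbv beta].

Tactic Notation "fassume" ident(H) :=
  apply force_imp_intro;
  let v := fresh "w" in let L := fresh "L" in intros v L H; cbv beta in H |- *; lift L.

Tactic Notation "fintro" ident(x) ident(H) := fintro x; fassume H.

Tactic Notation "fobtain" constr(H) "as" ident(x) ident(Hx) :=
  let v := fresh "w" in let L := fresh "L" in
  eapply force_ex_elim; [|exact H|]; [unif|];
  try clear H;
  intros v x L Hx; cbv beta in Hx; lift L.

Tactic Notation "fdestruct" hyp(H) "as" ident(H1) ident(H2) :=
  apply force_and_elim in H; destruct H as [H1 H2]; cbv beta in H1, H2.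

Tactic Notation "fobtain" constr(H) "as" ident(x) ident(Hx) ident(Hy) :=
  fobtain H as x Hx; fdestruct Hx as Hx Hy.

Tactic Notation "fhave" uconstr(H) "as" ident(x) ident(Hx) :=
  let v := fresh "w" in let L := fresh "L" in
  eapply force_ex_elim; [|refine H|]; [unif| |..];
  [intros v x L Hx; cbv beta in Hx; lift L|..].

Tactic Notation "fcases" constr(H) "as" ident(H1) :=
  eapply force_or_elim; [exact H| |];
  try clear H;
  (let v := fresh "w" in let L := fresh "L" in intros v L H1; cbv beta in H1; lift L).

Tactic Notation "fassert" ident(H) ":" uconstr(F) :=
  lazymatch goal with |- force ?w _ => assert (H : force w F) end.

Tactic Notation "fexists" constr(x) := apply (force_ex_intro _ _ x); [unif|cbv beta].

Tactic Notation "fapply" constr(H) :=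
  let K := fresh in pose proof H as K; read K; eapply K; clear K; cbv beta.

Tactic Notation "fapply" constr(H) "in" hyp(J) :=
  let K := fresh in pose proof H as K; read K; eapply K in J; clear K; cbv beta in J.

Tactic Notation "fsplit" := apply force_and_intro; cbv beta.
Tactic Notation "fleft" := apply force_or_left; cbv beta.
Tactic Notation "fright" := apply force_or_right; cbv beta.

(** Given [E : x ≡ y], replaces [y] by [x] everywhere. *)
Ltac fsubst E :=
  lazymatch type of E with force ?w (feq (par ?x) (par ?y)) =>
    let E' := fresh in
    pose proof (force_sym w x y E) as E'; clear E;
    repeat match goal with
    | K : force w ?F |- _ =>
        lazymatch K with E' => fail | _ => idtac end;
        lazymatch F with context [par y] => idtac end;
        lazymatch eval pattern (par y) in F with ?P _ =>
          apply (force_subst w P y x ltac:(unif) E') in K; cbv beta in K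
        end
    end;
    lazymatch goal with |- force w ?F =>
      lazymatch eval pattern (par y) in F with
      | ?P _ => apply (force_subst w P x y ltac:(unif) (force_sym w y x E')); cbv beta
      | _ => idtac
      end
    end;
    clear E'; try clear y
  end.

Lemma force_iff_intro w F G : (forall w', incl w w' -> w' ⊩ F -> w' ⊩ G) ->
  (forall w', incl w w' -> w' ⊩ G -> w' ⊩ F) -> w ⊩ (F ⇔ G).
Proof. intros H1 H2; apply force_and_intro; now apply force_imp_intro. Qed.

Tactic Notation "fiff" ident(H) :=
  apply force_iff_intro; cbv beta;
  (let v := fresh "w" in let L := fresh "L" in intros v L H; cbv beta in H |- *; lift L).

Lemma extensionality_ax w (a b : nat) : (w ⊩ FA x, x ∈ a ⇔ x ∈ b) -> w ⊩ a ≡ b.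
Proof.
  assert (H : w ⊩ (FA a, FA b, (FA x, x ∈ a ⇔ x ∈ b) ⇒ a ≡ b))
    by apply T_ax, CZF_ax, extensionality.
  read H; apply H.
Qed.

(** * Set theory *)

Lemma pairing_ax w (a b : nat) : w ⊩ EX c, FA x, x ∈ c ⇔ (x ≡ a ∨ x ≡ b).
Proof.
  assert (H : w ⊩ (FA a, FA b, EX c, FA x, x ∈ c ⇔ (x ≡ a ∨ x ≡ b)))
    by apply T_ax, CZF_ax, pairing.
  read H; apply H.
Qed.

Lemma union_ax w (a : nat) : w ⊩ is_set (fun x => EX y IN el a, x ∈ y).
Proof.
  assert (H : w ⊩ (FA a, EX b, FA x, x ∈ b ⇔ EX y IN el a, x ∈ y))
    by apply T_ax, CZF_ax, union.
  read H; apply H.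
Qed.

Ltac good_list := repeat constructor; (apply good_par || (apply good_bound; lia)).

Lemma separation_ax w (P : tm -> fm) A (a : nat) : restricted A ->
  (forall d x, good d x -> P x d = inst A [x] d) ->
  w ⊩ is_set (fun x => x ∈ a ∧ P x).
Proof.
  intros HA HP.
  assert (H : w ⊩ FA a, EX b, FA x, x ∈ b ⇔ (x ∈ a ∧ inst A [x]))
    by now apply T_ax, CZF_ax, restricted_separation.
  read H; specialize (H a).
  unfold is_set, represents, force, close, fiff, fand, fimp, fall, fex in *.
  rewrite !HP by good_list; exact H.
Qed.

(** This and [separation_sub] are the only instances of Restricted Separation in the proof. As [x]
    does not occur in [p ∈ q], here [a] is cut down by a truth value. *)
Lemma separation_mem w (a p q : nat) : w ⊩ is_set (fun x => x ∈ a ∧ p ∈ q).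
Proof.
  apply separation_ax with (A := Mem (S p) (S q)); [constructor|].
  intros d x _; unfold inst, fmem, par; destruct p, q; simpl; f_equal; lia.
Qed.

Lemma separation_sub w (a z : nat) : w ⊩ is_set (fun x => x ∈ a ∧ sub (el x) (el z)).
Proof.
  (* Under the quantifier, index 1 is the element being separated and [S (S z)] is the parameter
     [z]. *)
  apply separation_ax with (A := All (Imp (Mem 0 1) (Mem 0 (S (S z))))).
  { constructor; constructor. }
  intros d x Hx; unfold inst, sub, el, fall, fimp, fmem, par; rewrite (good_at_S d x Hx).
  destruct z; simpl; repeat f_equal; lia.
Qed.

(** The named predicate is exchanged for its de Bruijn formula [A], for which the scheme has an
    instance; the two agree because the quantified variables are [good] at the depths where they
    occur. *)
Lemma set_induction_ax w P : uniform1 P ->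
  (w ⊩ FA a, (FA x IN el a, P x) ⇒ P a) -> w ⊩ FA a, P a.
Proof.
  intros [A HA]%uniform_rep; apply force_imp_elim.
  assert (HP : forall d x, good d x -> P x d = inst A [x] d)
    by (intros d x Hx; apply (HA d [x]); auto).
  pose proof (set_induction A) as H; apply CZF_ax, (T_ax _ w) in H.
  unfold force, close, fimp, fall in *; rewrite !HP by good_list; exact H.
Qed.

Lemma strong_collection_ax w P (a : nat) : uniform2 P ->
  (w ⊩ FA x IN el a, EX y, P x y) ->
  w ⊩ EX b, (FA x IN el a, EX y IN el b, P x y) ∧ (FA y IN el b, EX x IN el a, P x y).
Proof.
  intros HU; pose proof HU as [A HA]%uniform_rep.
  assert (HP : forall d x y, good d x -> good d y -> P x y d = inst A [x; y] d)
    by (intros d x y Hx Hy; apply (HA d [x; y]); auto).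
  assert (H : w ⊩ FA a, (FA x IN el a, EX y, P x y) ⇒
      EX b, (FA x IN el a, EX y IN el b, P x y) ∧ (FA y IN el b, EX x IN el a, P x y)).
  { pose proof (strong_collection A) as H; apply CZF_ax, (T_ax _ w) in H.
    unfold force, close, fimp, fand, fall, fex in *; rewrite !HP by good_list; exact H. }
  read H; apply H.
Qed.

Lemma subset_collection_ax w P (a b : nat) : uniform3 P ->
  w ⊩ EX c, FA u, (FA x IN el a, EX y IN el b, P x y u) ⇒
      EX d IN el c, (FA x IN el a, EX y IN el d, P x y u) ∧
                    (FA y IN el d, EX x IN el a, P x y u).
Proof.
  intros HU; pose proof HU as [A HA]%uniform_rep.
  assert (HP : forall d x y u, good d x -> good d y -> good d u ->
      P x y u d = inst A [x; y; u] d)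
    by (intros d x y u Hx Hy Hu; apply (HA d [x; y; u]); auto).
  assert (H : w ⊩ FA a, FA b, EX c, FA u, (FA x IN el a, EX y IN el b, P x y u) ⇒
      EX d IN el c, (FA x IN el a, EX y IN el d, P x y u) ∧
                    (FA y IN el d, EX x IN el a, P x y u)).
  { pose proof (subset_collection A) as H; apply CZF_ax, (T_ax _ w) in H.
    unfold force, close, fimp, fand, fall, fex in *; rewrite !HP by good_list; exact H. }
  read H; apply H.
Qed.

Lemma wREA_weakly_regular w (a : nat) : w ⊩ EX c, weakly_regular c ∧ sub (el a) (el c).
Proof.
  assert (H : w ⊩ FA a, EX c, weakly_regular c ∧ sub (el a) (el c)) by apply T_ax, wREA_ax.
  read H; apply H.
Qed.

(** * Closure properties of sets *)

Lemma is_set_congr w X Y : uniform1 X -> uniform1 Y ->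
  (w ⊩ is_set X) -> (w ⊩ FA x, X x ⇔ Y x) -> w ⊩ is_set Y.
Proof.
  intros HX HY H E. fobtain H as s Hs. fexists s. fintro x. fiff Hx.
  - fapply E. fapply Hs. exact Hx.
  - fapply Hs. fapply E. exact Hx.
Qed.

(** Strong Collection gathers a set of sets that each represent some [P x] and among which every
    [P x] is represented; their union is the required set. *)
Lemma is_set_bigunion w P (a : nat) : uniform2 P ->
  (w ⊩ FA x IN el a, is_set (P x)) -> w ⊩ is_set (fun y => EX x IN el a, P x y).
Proof.
  intros HP H.
  apply (strong_collection_ax w (fun x s => represents s (P x)) a) in H; [|unif].
  fobtain H as c H1 H2.
  fhave (union_ax _ c) as u Hu.
  fexists u. fintro y. fiff Hy.
  - fapply Hu in Hy. fobtain Hy as s Hs Hy. fapply H2 in Hs. fobtain Hs as x Hx Hs.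
    fexists x. fsplit; [exact Hx|]. fapply Hs. exact Hy.
  - fobtain Hy as x Hx Hy. fapply H1 in Hx. fobtain Hx as s Hs Hx. fapply Hu.
    fexists s. fsplit; [exact Hs|]. fapply Hx. exact Hy.
Qed.

Lemma set_ext w (a b : nat) :
  (w ⊩ sub (el a) (el b)) -> (w ⊩ sub (el b) (el a)) -> w ⊩ a ≡ b.
Proof.
  intros H1 H2; apply extensionality_ax. fintro x. fiff H; [fapply H1|fapply H2]; exact H.
Qed.

Lemma is_set_or w X Y : uniform1 X -> uniform1 Y ->
  (w ⊩ is_set X) -> (w ⊩ is_set Y) -> w ⊩ is_set (fun x => X x ∨ Y x).
Proof.
  intros UX UY HX HY. fobtain HX as a Ha. fobtain HY as b Hb.
  fhave (pairing_ax _ a b) as c Hc. fhave (union_ax _ c) as u Hu.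
  fexists u. fintro x. fiff H.
  - fapply Hu in H. fobtain H as s Hs H. fapply Hc in Hs. fcases Hs as E; fsubst E.
    + fleft. fapply Ha. exact H.
    + fright. fapply Hb. exact H.
  - fapply Hu. fcases H as Hx.
    + fexists a. fsplit; [fapply Hc; fleft; apply force_refl|fapply Ha; exact Hx].
    + fexists b. fsplit; [fapply Hc; fright; apply force_refl|fapply Hb; exact Hx].
Qed.

Lemma is_set_el w (a : nat) : w ⊩ is_set (el a).
Proof. fexists a. fintro x. fiff H; exact H. Qed.

Lemma is_set_singleton w (a : nat) : w ⊩ is_set (fun x => x ≡ a).
Proof.
  fhave (pairing_ax _ a a) as c Hc. fexists c. fintro x. fiff H.
  - fapply Hc in H. fcases H as E; exact E.
  - fapply Hc. fleft. exact H.
Qed.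

(** * Kuratowski pairs *)

Lemma is_upair_unique w (x y z z' : nat) :
  (w ⊩ is_upair z x y) -> (w ⊩ is_upair z' x y) -> w ⊩ z ≡ z'.
Proof.
  intros H H'; apply set_ext; fintro u Hu.
  - fapply H'. fapply H. exact Hu.
  - fapply H. fapply H'. exact Hu.
Qed.

Lemma is_pair_unique w (x y p p' : nat) :
  (w ⊩ is_pair p x y) -> (w ⊩ is_pair p' x y) -> w ⊩ p ≡ p'.
Proof.
  intros H H'; apply set_ext; fintro u Hu.
  - fapply H'. fapply H. exact Hu.
  - fapply H. fapply H'. exact Hu.
Qed.

Lemma pair_exists w (x y : nat) : w ⊩ EX p, is_pair p x y.
Proof.
  fhave (pairing_ax _ x x) as a Ha. fhave (pairing_ax _ x y) as b Hb.
  fhave (pairing_ax _ a b) as p Hp.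
  fexists p. fintro z. fiff H.
  - fapply Hp in H. fcases H as E; fsubst E; [fleft|fright]; assumption.
  - fapply Hp. fcases H as Hz; [fleft|fright]; eapply is_upair_unique; eassumption.
Qed.

(** Here [{x, y}] belongs to [{{x}}], so [y] belongs to [{x}]. *)
Lemma is_pair_diagonal_inj w (p x y : nat) :
  (w ⊩ is_pair p x x) -> (w ⊩ is_pair p x y) -> w ⊩ x ≡ y.
Proof.
  intros H H'. fhave (pairing_ax _ x y) as b Hb.
  fassert Hbp : (b ∈ p); [fapply H'; fright; exact Hb|].
  fapply H in Hbp. apply force_sym.
  fcases Hbp as E; read E; specialize (E y);
    destruct E as [E _];
    (eapply force_or_elim; [apply E; fapply Hb; fright; apply force_refl| |]); auto.
Qed.

(** The singleton [{x}] is [{x'}] or [{x', y'}], and [x'] lies in both. *)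
Lemma is_pair_inj1 w (p x y x' y' : nat) :
  (w ⊩ is_pair p x y) -> (w ⊩ is_pair p x' y') -> w ⊩ x ≡ x'.
Proof.
  intros H H'. fhave (pairing_ax _ x x) as a Ha.
  fassert Hap : (a ∈ p); [fapply H; fleft; exact Ha|].
  fassert Hx : (x' ∈ a).
  { fapply H' in Hap. fcases Hap as E; fapply E; fleft; apply force_refl. }
  fapply Ha in Hx. fcases Hx as E; now apply force_sym.
Qed.

Lemma is_pair_inj2 w (p x y x' y' : nat) :
  (w ⊩ is_pair p x y) -> (w ⊩ is_pair p x' y') -> w ⊩ y ≡ y'.
Proof.
  intros H H'. pose proof (is_pair_inj1 _ _ _ _ _ _ H H') as E. fsubst E.
  fhave (pairing_ax _ x y) as b Hb.
  fassert Hbp : (b ∈ p); [fapply H; fright; exact Hb|].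
  fassert Hy : (y ∈ b); [fapply Hb; fright; apply force_refl|].
  (* The set [{x, y}] is [{x}] or [{x, y'}]. If this gives [y ≡ x], then [p] is a diagonal pair. *)
  fassert D : (y ≡ x ∨ y ≡ y').
  { fapply H' in Hbp. fcases Hbp as E; fapply E in Hy; [|exact Hy].
    fcases Hy as Ey; fleft; exact Ey. }
  clear Hb Hbp Hy. fcases D as E; [|exact E].
  apply force_sym in E. fsubst E. eapply is_pair_diagonal_inj; eassumption.
Qed.

(** A singleton cut down by a truth value. In [stage_regular] the set [j] is a stage, which turns
    the unrestricted condition [stage] into a membership. *)
Lemma is_set_pairs w (x y b j : nat) : w ⊩ is_set (fun p => is_pair p x y ∧ b ∈ j).
Proof.
  fhave (pair_exists _ x y) as p0 Hp0. fhave (is_set_singleton _ p0) as a Ha.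
  apply (is_set_congr _ (fun p => p ∈ a ∧ b ∈ j)); [unif|unif|apply separation_mem|].
  fintro p. fiff H; fdestruct H as Hp H; fsplit; auto.
  - fapply Ha in Hp. apply force_sym in Hp. fsubst Hp. exact Hp0.
  - fapply Ha. eapply is_pair_unique; eassumption.
Qed.

Lemma is_set_pair w (x y : nat) : w ⊩ is_set (fun p => is_pair p x y).
Proof.
  fhave (pair_exists _ x y) as p0 Hp0.
  apply (is_set_congr _ (fun p => p ≡ p0)); [unif|unif|apply is_set_singleton|].
  fintro p. fiff H.
  - apply force_sym in H. fsubst H. exact Hp0.
  - eapply is_pair_unique; eassumption.
Qed.

(** * Images of sets *)

(** The first two clauses have the shape of the conclusion of Subset Collection. Single-valuedness
    is global and [f ⊆ u × X] is not demanded. *)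
Definition onto (f u X : tm) : fm :=
  (FA i IN el u, EX y IN el X, rel (el f) i y) ∧
  (FA y IN el X, EX i IN el u, rel (el f) i y) ∧
  (FA i, FA y, FA y', rel (el f) i y ⇒ rel (el f) i y' ⇒ y' ≡ y).
#[local] Hint Unfold onto : fm_defs.

Lemma rel_el_intro w (h p x y : nat) :
  (w ⊩ p ∈ h) -> (w ⊩ is_pair p x y) -> w ⊩ rel (el h) x y.
Proof. intros H1 H2. fexists p. fsplit; assumption. Qed.

(** Through the identity, the sets [W ∈ D(b)] count as images of elements of [beta], just like the
    premise sets of [Phi]. *)
Lemma identity_onto w (X : nat) : w ⊩ EX f, onto f X X.
Proof.
  fassert H : (is_set (fun p => EX i IN el X, is_pair p i i)).
  { apply (is_set_bigunion w (fun i p => is_pair p i i)); [unif|].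
    fintro i Hi. apply is_set_pair. }
  fobtain H as f Hf.
  fassert D : (FA i IN el X, rel (el f) i i).
  { fintro i Hi. fhave (pair_exists _ i i) as p Hp.
    apply rel_el_intro with p; [|exact Hp]. fapply Hf. fexists i. fsplit; auto. }
  fassert E : (FA i, FA y, rel (el f) i y ⇒ y ≡ i).
  { fintro i. fintro y Hy. fobtain Hy as p Hp Hy. fapply Hf in Hp.
    fobtain Hp as j Hj Hp.
    apply force_sym. pose proof (is_pair_inj1 _ _ _ _ _ _ Hy Hp) as E.
    apply force_sym in E. fsubst E. apply force_sym. eapply is_pair_inj2; eassumption. }
  fexists f. repeat apply force_and_intro; cbv beta.
  - fintro i Hi. fexists i. fsplit; [exact Hi|fapply D; exact Hi].
  - fintro i Hi. fexists i. fsplit; [exact Hi|fapply D; exact Hi].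
  - fintro i. fintro y. fintro y' Hy. fassume Hy'. fapply E in Hy. fapply E in Hy'.
    fsubst Hy. exact Hy'.
Qed.

(** Since [f] is contained in [u × Y], uniqueness of values on [u] is uniqueness everywhere. *)
Lemma surjection_onto w (f u X : nat) Y : uniform1 Y ->
  (w ⊩ surjection (el f) (el u) Y) -> (w ⊩ represents X Y) -> w ⊩ onto f u X.
Proof.
  intros UY H HX. fdestruct H as HM HS. fdestruct HM as HP HF.
  fassert D : (FA i, FA y, rel (el f) i y ⇒ i ∈ u ∧ y ∈ X).
  { fintro i. fintro y Hy. fobtain Hy as p Hp Hy. fapply HP in Hp.
    fobtain Hp as i' Hi Hp. fobtain Hp as y' Hy' Hp.
    pose proof (is_pair_inj1 _ _ _ _ _ _ Hp Hy) as E. fsubst E.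
    pose proof (is_pair_inj2 _ _ _ _ _ _ Hp Hy) as E. fsubst E.
    fsplit; [exact Hi|fapply HX; exact Hy']. }
  repeat apply force_and_intro; cbv beta.
  - fintro i Hi. fapply HF in Hi. fobtain Hi as y Hy HU. fexists y. fsplit; [|exact Hy].
    fapply D. exact Hy.
  - fintro y Hy. fapply HX in Hy. fapply HS in Hy. exact Hy.
  - fintro i. fintro y. fintro y' Hy. fassume Hy'.
    fassert Hi : (i ∈ u); [fapply D; exact Hy|].
    fapply HF in Hi. fobtain Hi as z Hz HU. fapply HU in Hy. fapply HU in Hy'.
    apply force_sym in Hy. fsubst Hy. exact Hy'.
Qed.

(** For each [u ∈ a], Subset Collection with the parameter [f] gives one set of candidate images
    that serves all [f]. Strong Collection and Union combine these over [u]. *)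
Lemma images_set w (a b : nat) :
  w ⊩ EX C, FA u IN el a, FA f, FA X,
    sub (el X) (el b) ⇒ onto f u X ⇒ X ∈ C.
Proof.
  fassert H : (FA u IN el a, EX c, FA f,
      (FA i IN el u, EX y IN el b, rel (el f) i y) ⇒
      EX d IN el c, (FA i IN el u, EX y IN el d, rel (el f) i y) ∧
                    (FA y IN el d, EX i IN el u, rel (el f) i y)).
  { fintro u Hu. apply (subset_collection_ax _ (fun i y f => rel (el f) i y)); unif. }
  apply (strong_collection_ax w (fun u c => FA f,
      (FA i IN el u, EX y IN el b, rel (el f) i y) ⇒
      EX d IN el c, (FA i IN el u, EX y IN el d, rel (el f) i y) ∧
                    (FA y IN el d, EX i IN el u, rel (el f) i y)) a) in H; [|unif].
  fobtain H as K HK HK'. clear HK'.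
  fhave (union_ax _ K) as C HC. fexists C.
  fintro u Hu. fintro f. fintro X HX. fassume Ho.
  fapply HK in Hu. fobtain Hu as c Hc Hu.
  fdestruct Ho as H1 H2. fdestruct H2 as H2 H3.
  fassert H4 : (FA i IN el u, EX y IN el b, rel (el f) i y).
  { fintro i Hi. fapply H1 in Hi. fobtain Hi as y Hy Hi. fexists y. fsplit; [|exact Hi].
    fapply HX. exact Hy. }
  fapply Hu in H4. fobtain H4 as d Hd H4. fdestruct H4 as H4 H5.
  (* Subset Collection only relates [d] and [u] in both directions by [f]; as [f] is single-valued,
     [d] and [X] are both the image of [u]. *)
  fassert E : (d ≡ X).
  { apply set_ext.
    - fintro y Hy. fapply H5 in Hy. fobtain Hy as i Hi Hy.
      fapply H1 in Hi. fobtain Hi as y' Hy' Hi.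
      fassert E : (y' ≡ y).
      { fapply H3; [exact Hy|exact Hi]. }
      fsubst E. exact Hy'.
    - fintro y Hy. fapply H2 in Hy. fobtain Hy as i Hi Hy.
      fapply H4 in Hi. fobtain Hi as y' Hy' Hi.
      fassert E : (y' ≡ y).
      { fapply H3; [exact Hy|exact Hi]. }
      fsubst E. exact Hy'. }
  fsubst E. fapply HC. fexists c. fsplit; assumption.
Qed.

(** * Iterating a set-indexed family of rules *)

(** [R X b] is the rule with premise set [X] and conclusion [b]. A pair [(x, b)] in [h] records that
    [b] is reached at stage [x] from premises reached at stages in [x]. *)
Definition derivation (C : tm) (R : tm -> cls) (h : tm) : fm :=
  FA x, FA b, rel (el h) x b ⇒
    EX X IN el C, R X b ∧ FA c IN el X, EX y IN el x, rel (el h) y c.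

(** [h] is closed under passing to premises but need not be all of the graph of
    the stages, so derivations can be united without any uniqueness argument. *)
Definition stage (C : tm) (R : tm -> cls) (x b : tm) : fm :=
  EX h, derivation C R h ∧ rel (el h) x b.
#[local] Hint Unfold derivation stage : fm_defs.

Lemma stage_inv w (C x b : nat) R : uniform2 R ->
  (w ⊩ stage C R x b) ->
  w ⊩ EX X IN el C, R X b ∧ FA c IN el X, EX y IN el x, stage C R y c.
Proof.
  intros UR H. fobtain H as h Hh H.
  pose proof Hh as K. unfold derivation in K. fapply K in H.
  fobtain H as X HX H. fdestruct H as Hb H.
  fexists X. fsplit; [exact HX|]. fsplit; [exact Hb|]. fintro c Hc.
  fapply H in Hc. fobtain Hc as y Hy Hc. fexists y. fsplit; [exact Hy|].
  fexists h. fsplit; assumption.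
Qed.

(** Strong Collection yields, without choice, a set [G] of derivations that covers all premises. Its
    union together with the pair [(x, b)] is again a derivation. *)
Lemma stage_intro w (C X x b : nat) R : uniform2 R ->
  (w ⊩ X ∈ C) -> (w ⊩ R X b) ->
  (w ⊩ FA c IN el X, EX y IN el x, stage C R y c) -> w ⊩ stage C R x b.
Proof.
  intros UR HX Hb H.
  fassert K : (FA c IN el X, EX h, derivation C R h ∧ EX y IN el x, rel (el h) y c).
  { fintro c Hc. fapply H in Hc. fobtain Hc as y Hy Hc. fobtain Hc as h Hh Hc.
    fexists h. fsplit; [exact Hh|]. fexists y. fsplit; assumption. }
  apply (strong_collection_ax _
    (fun c h => derivation C R h ∧ EX y IN el x, rel (el h) y c)) in K; [|unif].
  fobtain K as G HG HG'. fhave (union_ax _ G) as u Hu.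
  fhave (pair_exists _ x b) as p Hp.
  fassert Hh : (is_set (fun q => q ∈ u ∨ q ≡ p)).
  { apply is_set_or; [unif|unif|apply is_set_el|apply is_set_singleton]. }
  fobtain Hh as h Hh.
  fassert Hsub : (FA g IN el G, FA y, FA c, rel (el g) y c ⇒ rel (el h) y c).
  { fintro g Hg. fintro y. fintro c Hc. fobtain Hc as q Hq Hc.
    apply rel_el_intro with q; [|exact Hc]. fapply Hh. fleft. fapply Hu.
    fexists g. fsplit; assumption. }
  fexists h. fsplit.
  - fintro y. fintro c Hc. fobtain Hc as q Hq Hc. fapply Hh in Hq. fcases Hq as Hq.
    + fapply Hu in Hq. fobtain Hq as g Hg Hq. pose proof Hg as Hg2. fapply HG' in Hg2.
      fobtain Hg2 as c' Hc' Hg2. fdestruct Hg2 as Hd Hg2.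
      fassert Hr : (rel (el g) y c). { apply rel_el_intro with q; assumption. }
      unfold derivation in Hd. fapply Hd in Hr. fobtain Hr as X' HX' Hr. fdestruct Hr as Hc2 Hr.
      fexists X'. fsplit; [exact HX'|]. fsplit; [exact Hc2|]. fintro e He. fapply Hr in He.
      fobtain He as z Hz He. fexists z. fsplit; [exact Hz|]. fapply Hsub; eassumption.
    + fsubst Hq.
      pose proof (is_pair_inj1 _ _ _ _ _ _ Hc Hp) as E. fsubst E.
      pose proof (is_pair_inj2 _ _ _ _ _ _ Hc Hp) as E. fsubst E.
      fexists X. fsplit; [exact HX|]. fsplit; [exact Hb|]. fintro e He. fapply HG in He.
      fobtain He as g Hg He. fdestruct He as Hd He. fobtain He as z Hz He.
      fexists z. fsplit; [exact Hz|]. fapply Hsub; eassumption.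
  - apply rel_el_intro with p; [|exact Hp]. fapply Hh. fright. apply force_refl.
Qed.

(** By set induction the stages in [x] have a union [Z], a set. Stage [x] is then the union of the
    sets [R X] over the [X ∈ C] with [X ⊆ Z], and [X ⊆ Z] is restricted. *)
Lemma stage_set w (C : nat) R : uniform2 R ->
  (w ⊩ FA X IN el C, is_set (R X)) -> w ⊩ FA x, is_set (stage C R x).
Proof.
  intros UR HR. apply set_induction_ax; [unif|]. fintro x IH.
  apply (is_set_bigunion _ (stage C R)) in IH; [|unif]. fobtain IH as Z HZ.
  fhave (separation_sub _ C Z) as D HD.
  apply (is_set_congr _ (fun b => EX X IN el D, R X b)); [unif|unif| |].
  - apply is_set_bigunion; [unif|]. fintro X HX. fapply HD in HX. fdestruct HX as HX HXZ.
    fapply HR. exact HX.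
  - fintro b. fiff Hb.
    + fobtain Hb as X HX Hb. fapply HD in HX. fdestruct HX as HX HXZ.
      apply stage_intro with X; [exact UR|exact HX|exact Hb|].
      fintro c Hc. fapply HZ. fapply HXZ. exact Hc.
    + apply stage_inv in Hb; [|exact UR]. fobtain Hb as X HX Hb.
      fdestruct Hb as Hb H. fexists X. fsplit; [|exact Hb]. fapply HD. fsplit; [exact HX|].
      fintro c Hc. fapply HZ. fapply H. exact Hc.
Qed.

Lemma stage_least w (C : nat) R Y : uniform2 R -> uniform1 Y ->
  (w ⊩ FA X IN el C, FA b, R X b ⇒ sub (el X) Y ⇒ Y b) ->
  w ⊩ FA x, sub (stage C R x) Y.
Proof.
  intros UR UY HY. apply set_induction_ax; [unif|]. fintro x IH.
  fintro b Hb. apply stage_inv in Hb; [|exact UR].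
  fobtain Hb as X HX Hb. fdestruct Hb as Hb H. fapply HY; [exact HX|exact Hb|].
  fintro c Hc. fapply H in Hc. fobtain Hc as y Hy Hc. fapply IH; eassumption.
Qed.

(** Let [T] relate [i ∈ u] to those [x ∈ A] at whose stage [f(i)] occurs. Weak regularity gives
    [v ∈ A] containing such an [x] for every [i], so [b] is reached at stage [v]. *)
Lemma stage_regular w (C A : nat) R : uniform2 R ->
  (w ⊩ FA X IN el C, is_set (R X)) -> (w ⊩ weakly_regular A) ->
  w ⊩ FA u IN el A, FA f, FA X IN el C, onto f u X ⇒ FA b, R X b ⇒
    (FA c IN el X, EX x IN el A, stage C R x c) ⇒ EX x IN el A, stage C R x b.
Proof.
  intros UR HR HA. pose proof (stage_set w C R UR HR) as HS.
  fintro u Hu. fintro f. fintro X HX. fassume Hf. fintro b Hb. fassume H.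
  fdestruct Hf as H1 H2. fdestruct H2 as H2 H3.
  (* The formula [stage] is not restricted. For fixed [i] and [x], however, [c] is determined by [i]
     and the stage is a set [j], so the condition becomes [c ∈ j]. *)
  fassert HT : (is_set (fun p => EX i IN el u, EX x IN el A,
     EX c, rel (el f) i c ∧ stage C R x c ∧ is_pair p i x)).
  { apply (is_set_bigunion _ (fun i p => EX x IN el A,
      EX c, rel (el f) i c ∧ stage C R x c ∧ is_pair p i x)); [unif|].
    fintro i Hi. fapply H1 in Hi. fobtain Hi as c Hc Hi.
    apply (is_set_bigunion _ (fun x p =>
      EX c, rel (el f) i c ∧ stage C R x c ∧ is_pair p i x)); [unif|].
    fintro x Hx. pose proof HS as HS'. read HS'. specialize (HS' x). fobtain HS' as j Hj.
    apply (is_set_congr _ (fun p => is_pair p i x ∧ c ∈ j)); [unif|unif|apply is_set_pairs|].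
    fintro p. fiff Hp.
    - fdestruct Hp as Hp Hcj. fexists c. fsplit; [exact Hi|]. fsplit; [|exact Hp].
      fapply Hj. exact Hcj.
    - fobtain Hp as c' Hc' Hp. fdestruct Hp as Hst Hp. fsplit; [exact Hp|].
      fassert E : (c' ≡ c). { fapply H3; [exact Hi|exact Hc']. }
      fsubst E. fapply Hj. exact Hst. }
  fobtain HT as T HT.
  fassert HTs : (sub_prod (el T) (el u) (el A)).
  { fintro p Hp. fapply HT in Hp. fobtain Hp as i Hi Hp. fobtain Hp as x Hx Hp.
    fobtain Hp as c Hc Hp. fdestruct Hp as Hst Hp.
    fexists i. fsplit; [exact Hi|]. fexists x. fsplit; assumption. }
  fassert HTt : (FA i IN el u, EX x, rel (el T) i x).
  { fintro i Hi. pose proof Hi as Hi'. fapply H1 in Hi'. fobtain Hi' as c Hc Hic.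
    fapply H in Hc. fobtain Hc as x Hx Hc. fexists x.
    fhave (pair_exists _ i x) as p Hp. apply rel_el_intro with p; [|exact Hp].
    fapply HT. fexists i. fsplit; [exact Hi|]. fexists x. fsplit; [exact Hx|].
    fexists c. fsplit; [exact Hic|]. fsplit; assumption. }
  pose proof HA as HA'. read HA'. destruct HA' as [_ [_ reg]].
  pose proof (reg u Hu T HTs HTt) as Hv. clear reg.
  fobtain Hv as v HvA Hv. fexists v. fsplit; [exact HvA|].
  apply stage_intro with X; [exact UR|exact HX|exact Hb|].
  fintro c Hc. fapply H2 in Hc. fobtain Hc as i Hi Hc. fapply Hv in Hi.
  fobtain Hi as y Hy Hi. fexists y. fsplit; [exact Hy|].
  (* A pair is in [T] because of some value [c'] of [f] at [i], and [c'] must be [c]. *)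
  fobtain Hi as p Hp Hi. fapply HT in Hp. fobtain Hp as i' Hi' Hp.
  fobtain Hp as x Hx Hp. fobtain Hp as c' Hc' Hp. fdestruct Hp as Hst Hp.
  pose proof (is_pair_inj1 _ _ _ _ _ _ Hp Hi) as E. fsubst E.
  pose proof (is_pair_inj2 _ _ _ _ _ _ Hp Hi) as E. fsubst E.
  fassert E : (c' ≡ c). { fapply H3; [exact Hc|exact Hc']. }
  fsubst E. exact Hst.
Qed.

(** * The least closed class *)

(** One rule for both closure conditions. A pair [(b, a)] in [Phi] is met with [X] the set [↓a] of
    generators, whose supremum is [a]. *)
Definition derives (L leq Phi : cls) (B X b : tm) : fm :=
  EX s, is_sup L leq X s ∧ b ∈ B ∧ (rel leq b s ∨ rel Phi b s).
#[local] Hint Unfold derives : fm_defs.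

Section Semilattice.
Variables (L leq D Phi : cls) (B : nat).
Hypotheses (UL : uniform1 L) (Uleq : uniform1 leq) (UD : uniform1 D) (UPhi : uniform1 Phi).

Lemma is_sup_unique w (U s s' : nat) :
  (w ⊩ semilattice L leq) -> (w ⊩ is_sup L leq U s) -> (w ⊩ is_sup L leq U s') -> w ⊩ s ≡ s'.
Proof.
  intros HL H H'. read HL. destruct HL as [[_ [_ [_ anti]]] _].
  fdestruct H as Hs H1. fdestruct H1 as H1 H2.
  fdestruct H' as Hs' H1'. fdestruct H1' as H1' H2'.
  apply anti; auto.
  - fapply H2; [exact Hs'|]. exact H1'.
  - fapply H2'; [exact Hs|]. exact H1.
Qed.

(** With [s] the supremum of [X], the conclusions are the generators below [s], a set by
    set-generation, and those paired with [s] in [Phi], a set by boundedness. *)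
Lemma derives_set w (X : nat) :
  (w ⊩ semilattice L leq) -> (w ⊩ set_generated L leq B) -> (w ⊩ bounded L leq B Phi) ->
  (w ⊩ sub (el X) (el B)) -> w ⊩ is_set (derives L leq Phi B X).
Proof.
  intros HL HG HB HX.
  fassert HXL : (sub (el X) L).
  { fintro x Hx. fdestruct HG as HBL HG. fapply HBL. fapply HX. exact Hx. }
  pose proof HL as HS. fdestruct HS as HP HS. fapply HS in HXL. fobtain HXL as s Hs.
  fdestruct HG as HBL HG. fdestruct HB as HB Hal. clear HBL Hal.
  pose proof Hs as HsL. fdestruct HsL as HsL Hs1. clear Hs1.
  pose proof HsL as HsL2.
  fapply HG in HsL. destruct HsL as [Hdown _].
  fapply HB in HsL2.
  apply (is_set_congr _ (fun b => down leq B s b ∨ (b ∈ B ∧ rel Phi b s))); [unif|unif| |].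
  { apply is_set_or; [unif|unif|exact Hdown|exact HsL2]. }
  fintro b. fiff Hb.
  - fexists s. fsplit; [exact Hs|]. fcases Hb as Hb; fdestruct Hb as HbB Hb; fsplit; auto;
      [fleft|fright]; exact Hb.
  - fobtain Hb as s' Hs' Hb. pose proof (is_sup_unique _ _ _ _ HL Hs Hs') as E. fsubst E.
    fdestruct Hb as HbB Hb. fcases Hb as Hb; [fleft|fright]; fsplit; assumption.
Qed.

(** If [X ⊆ Y], then [Y] contains all generators below [⋁X]. This settles the first kind of
    conclusion and is the premise needed for the second. *)
Lemma Phi_closed_derives w Y : uniform1 Y -> (w ⊩ Phi_closed L leq B Phi Y) ->
  w ⊩ FA X, FA b, derives L leq Phi B X b ⇒ sub (el X) Y ⇒ Y b.
Proof.
  intros UY HY. fintro X. fintro b Hb. fassume HX.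
  fobtain Hb as s Hs Hb. fdestruct HY as HY1 HY. fdestruct HY as HY2 HY3.
  fassert HD : (sub (down leq B s) Y). { fintro c Hc. fapply HY2; eassumption. }
  fdestruct Hb as HbB Hb. fcases Hb as Hb.
  - fapply HD. fsplit; assumption.
  - fapply HY3; eassumption.
Qed.

(** [Y] may be any class. Arbitrary [Y] yields leastness of the intersection of the closed sets;
    taking that intersection as [Y] shows that it is a set. *)
Lemma closed_set_below w Y : uniform1 Y ->
  (w ⊩ set_presented L leq B D) ->
  (w ⊩ abstract_inductive_definition L B Phi) ->
  (w ⊩ bounded L leq B Phi) ->
  (w ⊩ Phi_closed L leq B Phi Y) ->
  w ⊩ EX s, Phi_closed L leq B Phi (el s) ∧ sub (el s) Y.
Proof.
  intros UY HP HA HB HY.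
  fdestruct HP as HL HP. fdestruct HP as HG HP. fdestruct HP as HD HP.
  pose proof HB as Hal. fdestruct Hal as Hal1 Hal. clear Hal1. fobtain Hal as alpha Hal.
  fassert Hbeta : (is_set (fun W => W ∈ alpha ∨
      EX b IN el B, EX Db, rel D b Db ∧ W ∈ Db)).
  { apply is_set_or; [unif|unif|apply is_set_el|].
    apply (is_set_bigunion _ (fun b W => EX Db, rel D b Db ∧ W ∈ Db)); [unif|].
    fintro b Hb. fdestruct HD as HD1 HD. fapply HD in Hb. fobtain Hb as Db Hb HDb.
    apply (is_set_congr _ (el Db)); [unif|unif|apply is_set_el|].
    fintro W. fiff HW.
    - fexists Db. fsplit; [exact Hb|exact HW].
    - fobtain HW as Db' HDb' HW. fapply HDb in HDb'. fsubst HDb'. exact HW. }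
  fobtain Hbeta as beta Hbeta.
  fhave (images_set _ beta B) as C0 HC0.
  fhave (separation_sub _ C0 B) as C HC.
  fhave (wREA_weakly_regular _ beta) as A HAr. fdestruct HAr as HAr HbA.
  fassert HR : (FA X IN el C, is_set (derives L leq Phi B X)).
  { fintro X HX. fapply HC in HX. fdestruct HX as HX HXB. apply derives_set; assumption. }
  assert (UR : uniform2 (derives L leq Phi B)) by unif.
  fassert Hs : (is_set (fun b => EX x IN el A, stage C (derives L leq Phi B) x b)).
  { apply (is_set_bigunion _ (stage C (derives L leq Phi B))); [unif|].
    pose proof (stage_set _ _ _ UR HR) as HS. fintro x Hx. fapply HS. }
  fobtain Hs as s Hs.
  fassert HsY : (sub (el s) Y).
  { fintro b Hb. fapply Hs in Hb. fobtain Hb as x Hx Hb.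
    pose proof (Phi_closed_derives _ _ UY HY) as HY'.
    fassert HYC : (FA X IN el C, FA b, derives L leq Phi B X b ⇒ sub (el X) Y ⇒ Y b).
    { fintro X HX. fintro c Hc. fassume Hc'. fapply HY'; eassumption. }
    pose proof (stage_least _ _ _ _ UR UY HYC) as HLe. fapply HLe. exact Hb. }
  fassert HsB : (sub (el s) (el B)).
  { fintro b Hb. fdestruct HY as HY1 HY2. fapply HY1. fapply HsY. exact Hb. }
  (* Closure of [s] under every rule whose premise set is an image of an element of [beta]; both
     closure conditions reduce to this. *)
  fassert Hkey : (FA u IN el beta, FA f, FA X, onto f u X ⇒
      FA b, derives L leq Phi B X b ⇒ sub (el X) (el s) ⇒ b ∈ s).
  { pose proof (stage_regular _ _ _ _ UR HR HAr) as Hreg.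
    fintro u Hu. fintro f. fintro X Hf. fintro b Hb. fassume HX.
    fassert HXC : (X ∈ C).
    { fassert HXB : (sub (el X) (el B)).
      { fintro c Hc. fapply HsB. fapply HX. exact Hc. }
      fapply HC. fsplit; [|exact HXB]. fapply HC0; eassumption. }
    fapply Hs. fapply Hreg; [|exact HXC|exact Hf|exact Hb|].
    - fapply HbA. exact Hu.
    - fintro c Hc. fapply Hs. fapply HX. exact Hc. }
  fexists s. fsplit; [|exact HsY]. fsplit; [exact HsB|]. fsplit.
  - fintro U HU. fintro t Ht. fintro b Hb. fdestruct Hb as HbB Hb.
    fassert HUB : (sub (el U) (el B)).
    { fintro c Hc. fapply HsB. fapply HU. exact Hc. }
    (* [U] itself need not be an image of an element of [beta]. Set-presentation replaces it by some
       [W ⊆ U] in [D(b)], and applied to [W] it gives [b ≤ ⋁W]. *)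
    fassert HW : (EX Db, rel D b Db ∧ EX W IN el Db, sub (el W) (el U)).
    { fapply HP; eassumption. }
    fobtain HW as Db HDb HW. fobtain HW as W HW HWU.
    fassert HWB : (sub (el W) (el B)).
    { fintro c Hc. fapply HUB. fapply HWU. exact Hc. }
    fassert HWL : (sub (el W) L).
    { fintro c Hc. fdestruct HG as HBL HG. fapply HBL. fapply HWB. exact Hc. }
    pose proof HL as HS. fdestruct HS as HPo HS. fapply HS in HWL. fobtain HWL as t' Ht'.
    fassert Hbt' : (rel leq b t').
    { fapply HP; [exact HbB|exact HWB|exact Ht'|].
      fexists Db. fsplit; [exact HDb|]. fexists W. fsplit; [exact HW|].
      fintro c Hc. exact Hc. }
    fhave (identity_onto _ W) as f Hf.
    fapply Hkey; [|exact Hf| |].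
    + fapply Hbeta. fright. fexists b. fsplit; [exact HbB|]. fexists Db. fsplit; assumption.
    + fexists t'. fsplit; [exact Ht'|]. fsplit; [exact HbB|]. fleft. exact Hbt'.
    + fintro c Hc. fapply HU. fapply HWU. exact Hc.
  - fintro b. fintro a Hba. fassume Ha.
    fassert HbaL : (b ∈ B ∧ L a).
    { fobtain Hba as p Hp Hba. fapply HA in Hp. fobtain Hp as b' Hb' Hp. fobtain Hp as a' Ha' Hp.
      pose proof (is_pair_inj1 _ _ _ _ _ _ Hba Hp) as E. apply force_sym in E. fsubst E.
      pose proof (is_pair_inj2 _ _ _ _ _ _ Hba Hp) as E. apply force_sym in E. fsubst E.
      fsplit; assumption. }
    fdestruct HbaL as HbB HaL.
    fassert HX : (is_set (down leq B a)).
    { fdestruct HG as HBL HG. fapply HG. exact HaL. }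
    fobtain HX as X HX.
    fassert HXs : (is_sup L leq X a).
    { fdestruct HG as HBL HG. fapply HG; [exact HaL|exact HX]. }
    (* The bound makes the generators below [a] an image of some [u] in [alpha], hence in [beta]. *)
    pose proof Hba as Hu. fapply Hal in Hu. fobtain Hu as u Hu Hf. fobtain Hf as f Hf.
    pose proof (surjection_onto _ _ _ X (down leq B a) ltac:(unif) Hf HX) as Ho.
    fapply Hkey; [|exact Ho| |].
    + fapply Hbeta. fleft. exact Hu.
    + fexists a. fsplit; [exact HXs|]. fsplit; [exact HbB|]. fright. exact Hba.
    + fintro c Hc. fapply Ha. fapply HX. exact Hc.
Qed.

(** * The intersection of all closed sets *)

(** Only sets are quantified over, so the intersection is given by a formula. *)
Definition least_class : cls := fun b => FA s, Phi_closed L leq B Phi (el s) ⇒ b ∈ s.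
#[local] Hint Unfold least_class : fm_defs.

Lemma least_class_below w Y : uniform1 Y ->
  (w ⊩ set_presented L leq B D) ->
  (w ⊩ abstract_inductive_definition L B Phi) ->
  (w ⊩ bounded L leq B Phi) ->
  w ⊩ Phi_closed L leq B Phi Y ⇒ sub least_class Y.
Proof.
  intros UY HP HA HB. fassume HY.
  pose proof (closed_set_below _ _ UY HP HA HB HY) as H. fobtain H as s Hs HsY.
  fintro b Hb. fapply HsY. unfold least_class in Hb. fapply Hb. exact Hs.
Qed.

Lemma least_class_closed w :
  (w ⊩ set_presented L leq B D) ->
  (w ⊩ abstract_inductive_definition L B Phi) ->
  (w ⊩ bounded L leq B Phi) ->
  w ⊩ Phi_closed L leq B Phi least_class.
Proof.
  intros HP HA HB. fsplit; [|fsplit].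
  (* [B] is itself closed, using [Phi ⊆ B × L], so the intersection lies below it. *)
  - eapply force_imp_elim; [apply least_class_below; auto; unif|].
    fsplit; [|fsplit].
    + fintro b Hb. exact Hb.
    + fintro U HU. fintro s Hs. fintro b Hb. fdestruct Hb as HbB Hb. exact HbB.
    + fintro b. fintro a Hba. fassume Ha.
      fobtain Hba as p Hp Hba. fapply HA in Hp. fobtain Hp as b' Hb' Hp. fobtain Hp as a' Ha' Hp.
      pose proof (is_pair_inj1 _ _ _ _ _ _ Hba Hp) as E. apply force_sym in E. fsubst E.
      exact Hb'.
  - fintro U HU. fintro t Ht. fintro b Hb. fintro s Hs.
    fassert HUs : (sub (el U) (el s)).
    { fintro c Hc. fapply HU in Hc. unfold least_class in Hc. fapply Hc. exact Hs. }
    fdestruct Hs as Hs1 Hs. fdestruct Hs as Hs Hs2. fapply Hs; eassumption.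
  - fintro b. fintro a Hba. fassume Ha. fintro s Hs.
    fassert Has : (sub (down leq B a) (el s)).
    { fintro c Hc. fapply Ha in Hc. unfold least_class in Hc. fapply Hc. exact Hs. }
    fdestruct Hs as Hs1 Hs. fdestruct Hs as Hs2 Hs. fapply Hs; eassumption.
Qed.

(** The intersection is closed, so it contains a closed set; being contained in every closed set, it
    equals that one. *)
Lemma least_class_set w :
  (w ⊩ set_presented L leq B D) ->
  (w ⊩ abstract_inductive_definition L B Phi) ->
  (w ⊩ bounded L leq B Phi) ->
  w ⊩ is_set least_class.
Proof.
  intros HP HA HB. assert (UI : uniform1 least_class) by unif.
  pose proof (least_class_closed _ HP HA HB) as HI.
  pose proof (closed_set_below _ _ UI HP HA HB HI) as H. fobtain H as s Hs HsI.
  fexists s. fintro b. fiff Hb.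
  - fapply HsI. exact Hb.
  - unfold least_class in Hb. fapply Hb. exact Hs.
Qed.
End Semilattice.

Theorem theorem4p9 (L leq D Phi : form) (B : nat) :
  let G :=
    [ close (set_presented (cl L) (cl leq) (par B) (cl D));
      close (abstract_inductive_definition (cl L) (par B) (cl Phi));
      close (bounded (cl L) (cl leq) (par B) (cl Phi)) ] in
  exists I : form,
    least_Phi_closed CZF_wREA G (cl L) (cl leq) (par B) (cl Phi) (cl I) /\
    prv CZF_wREA G (close (is_set (cl I))).
Proof.
  intros G.
  assert (UL := uniform_cl L). assert (Uleq := uniform_cl leq).
  assert (UD := uniform_cl D). assert (UPhi := uniform_cl Phi).
  assert (HP : G ⊩ set_presented (cl L) (cl leq) (par B) (cl D)) by (apply Hyp; simpl; auto).
  assert (HA : G ⊩ abstract_inductive_definition (cl L) (par B) (cl Phi))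
    by (apply Hyp; simpl; auto).
  assert (HB : G ⊩ bounded (cl L) (cl leq) (par B) (cl Phi)) by (apply Hyp; simpl; auto).
  assert (UI : uniform1 (least_class (cl L) (cl leq) (cl Phi) B)) by (unfold least_class; unif).
  (* [I] is the de Bruijn formula of the intersection, and [E] lets it replace the named version
     below the quantifiers of the three claims. *)
  destruct (uniform_rep _ _ UI) as [I HI].
  assert (E : forall d x, good d x -> least_class (cl L) (cl leq) (cl Phi) B x d = cl I x d)
    by (intros d x Hx; apply (HI d [x]); auto).
  exists I; split; [split; [|intros Y]|].
  - pose proof (least_class_closed _ _ _ _ _ UL Uleq UD UPhi _ HP HA HB) as H.
    unfold force, close, Phi_closed, cL_closed, sub, fand, fimp, fall in *.
    rewrite !E in H by good_list. exact H.
  - pose proof (least_class_below _ _ _ _ _ UL Uleq UD UPhi _ _ (uniform_cl Y) HP HA HB) as H.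
    unfold force, close, sub, fimp, fall in *.
    rewrite !E in H by good_list. exact H.
  - pose proof (least_class_set _ _ _ _ _ UL Uleq UD UPhi _ HP HA HB) as H.
    unfold force, close, is_set, represents, fiff, fand, fimp, fex, fall in *.
    rewrite !E in H by good_list. exact H.
Qed.
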